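(* The class of integral categories is not contained in the class of quasi-abelian categories; that is, there exists an integral category that is not quasi-abelian.
   Context: An additive category is pre-abelian if every morphism has a kernel and a cokernel. A morphism is called ''a kernel'' (resp. ''a cokernel'') if it is the kernel (resp. cokernel) of some morphism. A class $\mathcal{X}$ of morphisms is stable under pullback if in any pullback square with $a\colon A\to B$, $b\colon A\to C$, $c\colon B\to D$, $d\colon C\to D$ and $c\circ a=d\circ b$, one has $a\in\mathcal{X}$ whenever $d\in\mathcal{X}$; stability under pushout is defined dually. A pre-abelian category is quasi-abelian if cokernels are stable under pullback and kernels are stable under pushout. A pre-abelian category is integral if epimorphisms are stable under pullback and monomorphisms are stable under pushout. *)

(* Defs.v *)
From HB Require Import structures.
From mathcomp Require Import all_boot all_algebra.

Set Implicit Arguments.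
Unset Strict Implicit.
Unset Printing Implicit Defensive.

Import GRing.Theory.
Local Open Scope ring_scope.

(* Preadditive (Ab-enriched) categories; [comp g f] is "g after f". *)
Record preadditive := Preadditive {
  obj :> Type;
  hom : obj -> obj -> zmodType;
  idm : forall A, hom A A;
  comp : forall A B C, hom B C -> hom A B -> hom A C;
  comp1m : forall A B (f : hom A B), comp (idm B) f = f;
  compm1 : forall A B (f : hom A B), comp f (idm A) = f;
  compA : forall A B C D (h : hom C D) (g : hom B C) (f : hom A B),
    comp h (comp g f) = comp (comp h g) f;
  compDl : forall A B C (g1 g2 : hom B C) (f : hom A B),
    comp (g1 + g2) f = comp g1 f + comp g2 f;
  compDr : forall A B C (g : hom B C) (f1 f2 : hom A B),
    comp g (f1 + f2) = comp g f1 + comp g f2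
}.

Arguments hom {p} A B.
Arguments idm {p} A.
Arguments comp {p A B C} g f.

Declare Scope cat_scope.
Notation "g \oc f" := (comp g f) (at level 40, left associativity) : cat_scope.
Local Open Scope cat_scope.

Section Preadditive.
Variable C : preadditive.
Implicit Types A B D K P Q X Y Z : C.

Definition zero_object Z : Prop :=
  (forall X, exists! f : hom X Z, True) /\
  (forall X, exists! f : hom Z X, True).

Definition is_biproduct A B P (i1 : hom A P) (i2 : hom B P)
    (p1 : hom P A) (p2 : hom P B) : Prop :=
  [/\ p1 \oc i1 = idm A, p2 \oc i2 = idm B, p1 \oc i2 = 0, p2 \oc i1 = 0
    & i1 \oc p1 + i2 \oc p2 = idm P].

Definition additive_category : Prop :=
  (exists Z, zero_object Z) /\
  (forall A B, exists P (i1 : hom A P) (i2 : hom B P)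
     (p1 : hom P A) (p2 : hom P B), is_biproduct i1 i2 p1 p2).

Definition kernel_of A B K (f : hom A B) (k : hom K A) : Prop :=
  f \oc k = 0 /\
  forall X (g : hom X A), f \oc g = 0 -> exists! h : hom X K, k \oc h = g.

Definition cokernel_of A B Q (f : hom A B) (q : hom B Q) : Prop :=
  q \oc f = 0 /\
  forall X (g : hom B X), g \oc f = 0 -> exists! h : hom Q X, h \oc q = g.

Definition preabelian : Prop :=
  additive_category /\
  forall A B (f : hom A B),
    (exists K (k : hom K A), kernel_of f k) /\
    (exists Q (q : hom B Q), cokernel_of f q).

Definition morphism_class := forall A B, hom A B -> Prop.

Definition is_kernel : morphism_class := fun K A k =>
  exists B (f : hom A B), kernel_of f k.

Definition is_cokernel : morphism_class := fun B Q q =>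
  exists A (f : hom A B), cokernel_of f q.

Definition monomorphism : morphism_class := fun A B f =>
  forall X (g h : hom X A), f \oc g = f \oc h -> g = h.

Definition epimorphism : morphism_class := fun A B f =>
  forall X (g h : hom B X), g \oc f = h \oc f -> g = h.

(* In the next four definitions the square is
       A --a--> B
       |        |
       b        c
       v        v
       Y --d--> D                                                           *)
Definition pullback_square A B Y D
    (a : hom A B) (b : hom A Y) (c : hom B D) (d : hom Y D) : Prop :=
  c \oc a = d \oc b /\
  forall X (u : hom X B) (v : hom X Y), c \oc u = d \oc v ->
    exists! h : hom X A, a \oc h = u /\ b \oc h = v.

Definition pushout_square A B Y D
    (a : hom A B) (b : hom A Y) (c : hom B D) (d : hom Y D) : Prop :=
  c \oc a = d \oc b /\
  forall X (u : hom B X) (v : hom Y X), u \oc a = v \oc b ->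
    exists! h : hom D X, h \oc c = u /\ h \oc d = v.

Definition stable_under_pullback (M : morphism_class) : Prop :=
  forall A B Y D (a : hom A B) (b : hom A Y) (c : hom B D) (d : hom Y D),
    pullback_square a b c d -> M Y D d -> M A B a.

Definition stable_under_pushout (M : morphism_class) : Prop :=
  forall A B Y D (a : hom A B) (b : hom A Y) (c : hom B D) (d : hom Y D),
    pushout_square a b c d -> M A B a -> M Y D d.

Definition quasi_abelian : Prop :=
  [/\ preabelian, stable_under_pullback is_cokernel
    & stable_under_pushout is_kernel].

Definition integral : Prop :=
  [/\ preabelian, stable_under_pullback epimorphism
    & stable_under_pushout monomorphism].

End Preadditive.

(* Main.v *)
(* The category has as objects the finite-dimensional k[x]-modules V with a
   chosen subspace M of xV, and as morphisms the k[x]-linear maps preserving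
   these subspaces.  Kernels and cokernels are computed in k[x]-modules, the
   monomorphisms (epimorphisms) are the injective (surjective) maps, so the
   category is integral because k[x]-modules form an abelian category.
   Quasi-abelianness fails because the functor V |-> xV is not half exact.
   Let V = k[x]/(x^2) = <e, xe> and D = k = V/xV with the zero subspace.  Pull back
   the cokernel (V, 0) -> D along (V, <xe>) -> D, both sending e to 1.  The
   elements of x(V *_D V) are the x(w, w') with w and w' congruent modulo xV,
   i.e. the diagonal elements (xw, xw); since (V, 0) has zero subspace, the
   pullback has zero subspace as well, and its projection to (V, <xe>) is
   surjective but cannot be a cokernel. *)
From HB Require Import structures.
From mathcomp Require Import all_boot all_algebra.
Require Import Defs.

Set Implicit Arguments.
Unset Strict Implicit.
Unset Printing Implicit Defensive.

Import GRing.Theory.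
Local Open Scope ring_scope.
Local Open Scope cat_scope.

(** * Preadditive categories and pullbacks *)

Section PreadditiveTheory.
Variable C : preadditive.
Implicit Types A B D X Y : C.

Lemma comp0m A B D (f : hom A B) : (0 : hom B D) \oc f = 0.
Proof. by apply: (addrI ((0 : hom B D) \oc f)); rewrite -compDl !addr0. Qed.

Lemma compm0 A B D (g : hom B D) : g \oc (0 : hom A B) = 0.
Proof. by apply: (addrI (g \oc (0 : hom A B))); rewrite -compDr !addr0. Qed.

Lemma compNl A B D (g : hom B D) (f : hom A B) : (- g) \oc f = - (g \oc f).
Proof. by apply/eqP; rewrite -addr_eq0 -compDl addNr comp0m. Qed.

(** The pullback is the kernel of the difference map on the biproduct. The counterexample needs one
    because stability speaks only of given squares. *)
Lemma pullback_exists B Y D (c : hom B D) (d : hom Y D) : preabelian C ->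
  exists A (a : hom A B) (b : hom A Y), pullback_square a b c d.
Proof.
move=> [[_ biprod] kercoker].
have [P [i1 [i2 [p1 [p2 [p1i1 p2i2 p1i2 p2i1 iP]]]]]] := biprod B Y.
have [[A [k [k0 kP]]] _] := kercoker _ _ (c \oc p1 - d \oc p2).
exists A, (p1 \oc k), (p2 \oc k); split.
  by apply/eqP; rewrite -subr_eq0 !compA -compNl -compDl; apply/eqP.
move=> X u v cudv.
have p1w : p1 \oc (i1 \oc u + i2 \oc v) = u.
  by rewrite compDr !compA p1i1 p1i2 comp1m comp0m addr0.
have p2w : p2 \oc (i1 \oc u + i2 \oc v) = v.
  by rewrite compDr !compA p2i1 p2i2 comp1m comp0m add0r.
have [|h [kh hU]] := kP X (i1 \oc u + i2 \oc v).
  by rewrite compDl compNl -!compA p1w p2w cudv subrr.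
exists h; split=> [|h' [uh' vh']]; first by rewrite -!compA kh.
by apply: hU; rewrite -uh' -vh' !compA -!compDl iP comp1m.
Qed.

End PreadditiveTheory.

(** * Linear algebra over a field and the category of marked modules *)

Section MarkedModules.
Variable F : fieldType.

(** [p] is a linear retraction of the kernel inclusion [k], so the factorization through the kernel
    is the explicit matrix [g *m p]. *)
Lemma kermx_retract m n (f : 'M[F]_(m, n)) :
  exists r (k : 'M_(r, m)) (p : 'M_(m, r)),
    [/\ k *m f = 0, k *m p = 1%:M
      & forall l (g : 'M_(l, m)), g *m f = 0 -> g *m p *m k = g].
Proof.
exists _, (row_base (kermx f)), (pinvmx (row_base (kermx f))); split.
- by apply/sub_kermxP; rewrite eq_row_base.
- by rewrite mulmxVp ?row_base_free.
- by move=> l g gf; rewrite mulmxKpV // eq_row_base; apply/sub_kermxP.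
Qed.

Lemma cokermx_section m n (f : 'M[F]_(m, n)) :
  exists r (q : 'M_(n, r)) (p : 'M_(r, n)),
    [/\ f *m q = 0, p *m q = 1%:M
      & forall l (g : 'M_(n, l)), f *m g = 0 -> q *m (p *m g) = g].
Proof.
pose q := col_base (cokermx f).
have pq : pinvmx q *m q = 1%:M by rewrite mulVpmx ?col_base_full.
exists _, q, (pinvmx q); split=> [|//|l g fg].
  apply: (row_free_inj (row_base_free (cokermx f))).
  by rewrite -mulmxA mulmx_base mulmx_coker mul0mx.
apply/eqP; rewrite -subr_eq0 mulmxA -{2}[g]mul1mx -mulmxBl.
(* These rows are killed by [cokermx f], so they lie in the row space of [f], which [g] kills. *)
have /submxP[t ->] : (q *m pinvmx q - 1%:M <= f)%MS.
  rewrite submxE; suff <- : (q *m pinvmx q - 1%:M) *m (q *m row_base (cokermx f)) = 0.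
    by rewrite mulmx_base.
  by rewrite mulmxA mulmxBl -mulmxA pq mulmx1 mul1mx subrr mul0mx.
by rewrite -mulmxA fg mulmx0.
Qed.

(* The module is F^n, on which x acts by right multiplication by [act]; the
   subspace of xV is the row space of [mark :&: act], so that no condition on
   [mark] is needed. *)
Record mmod := MMod { dim : nat; act : 'M[F]_dim; mark : 'M[F]_dim }.

Definition marked (A : mmod) := (mark A :&: act A)%MS.

Definition is_mhom (A B : mmod) : {pred 'M[F]_(dim A, dim B)} := fun a =>
  (act A *m a == a *m act B) && (marked A *m a <= mark B)%MS.
Arguments is_mhom A B : clear implicits.

Lemma is_mhom_zmod_closed A B : zmod_closed (is_mhom A B).
Proof.
split=> [|a b /andP[/eqP ea ma] /andP[/eqP eb mb]]; rewrite unfold_in.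
  by rewrite mulmx0 mul0mx eqxx mulmx0 sub0mx.
by rewrite mulmxBr mulmxBl ea eb eqxx mulmxBr addmx_sub ?eqmx_opp.
Qed.
HB.instance Definition _ A B :=
  GRing.isZmodClosed.Build _ (is_mhom A B) (is_mhom_zmod_closed A B).

Record mhom A B := MHom { mx : 'M[F]_(dim A, dim B); _ : mx \in is_mhom A B }.
HB.instance Definition _ A B := [isSub for @mx A B].
HB.instance Definition _ A B := [Choice of mhom A B by <:].
HB.instance Definition _ A B := [SubChoice_isSubZmodule of mhom A B by <:].

Lemma act_mx A B (f : mhom A B) : act A *m mx f = mx f *m act B.
Proof. by case: f => a /= /andP[/eqP]. Qed.

(** Commuting with the actions already sends the image of [act A] into that of [act B], so asking
    only for [mark B] in [is_mhom] loses nothing. *)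
Lemma marked_mx A B (f : mhom A B) : (marked A *m mx f <= marked B)%MS.
Proof.
rewrite sub_capmx; case: f => a /= /andP[/eqP ea ->] /=.
by rewrite (submx_trans (submxMr a (capmxSr _ _))) // ea submxMl.
Qed.

Lemma mx_inj A B : injective (@mx A B).
Proof. exact: val_inj. Qed.

Lemma idmx_subproof A : 1%:M \in is_mhom A A.
Proof. by rewrite unfold_in mulmx1 mul1mx eqxx mulmx1 capmxSl. Qed.

Lemma mulmx_subproof A B C (g : mhom B C) (f : mhom A B) :
  mx f *m mx g \in is_mhom A C.
Proof.
rewrite unfold_in mulmxA act_mx -!mulmxA act_mx eqxx mulmxA.
by rewrite (submx_trans (submxMr _ (marked_mx f)))
  // (submx_trans (marked_mx g)) ?capmxSl.
Qed.

Definition mcat : preadditive.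
refine (@Preadditive mmod (fun A B => mhom A B : zmodType)
  (fun A => MHom (idmx_subproof A))
  (fun A B C g f => MHom (mulmx_subproof g f)) _ _ _ _ _) => *;
  apply: mx_inj => /=.
- exact: mulmx1.
- exact: mul1mx.
- by rewrite mulmxA.
- exact: mulmxDr.
- exact: mulmxDl.
Defined.

(** * Kernels, cokernels and biproducts of marked modules *)

Implicit Types A B D : mcat.

Lemma mhomP A B (a : 'M_(dim A, dim B)) :
  act A *m a = a *m act B -> (marked A *m a <= mark B)%MS ->
  {f : hom A B | mx f = a}.
Proof.
move=> ea ma; have af : a \in is_mhom A B by rewrite unfold_in ea eqxx.
by exists (MHom af).
Qed.

Lemma mx_comp A B D (g : hom B D) (f : hom A B) : mx (g \oc f) = mx f *m mx g.
Proof. by []. Qed.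

Lemma mxD A B (f g : hom A B) : mx (f + g) = mx f + mx g.
Proof. by []. Qed.

Lemma mxB A B (f g : hom A B) : mx (f - g) = mx f - mx g.
Proof. by []. Qed.

Lemma mx0 A B : mx (0 : hom A B) = 0.
Proof. by []. Qed.

Lemma mx_idm A : mx (idm A) = 1%:M.
Proof. by []. Qed.

(** The second clause ranges over all matrices because it is later applied to linear maps that need
    not commute with the actions. *)
Lemma mcat_kernel A B (f : hom A B) :
  exists (K : mcat) (k : hom K A), kernel_of f k /\
    forall m (g : 'M_(m, _)), g *m mx f = 0 -> exists h, g = h *m mx k.
Proof.
have [r [k [p [kf kp pk]]]] := kermx_retract (mx f).
pose K := MMod (k *m act A *m p) <<(mark A :&: k)%MS *m p>>%MS.
have [||k' k'E] := @mhomP K A k.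
- by rewrite /= pk // -mulmxA act_mx mulmxA kf mul0mx.
- rewrite (submx_trans (submxMr k (capmxSl _ _))) //=.
  have /submxP[w wE] : (mark A :&: k <= k)%MS := capmxSr _ _.
  by rewrite (eqmxMr k (genmxE _)) pk ?capmxSl // wE -mulmxA kf mulmx0.
exists K, k'; rewrite k'E; split=> [|m g /pk <-]; last by eexists.
split=> [|X g gf]; first by apply: mx_inj; rewrite mx_comp k'E.
have gpk : mx g *m p *m k = mx g by rewrite pk // -mx_comp gf.
have [||h hE] := @mhomP X K (mx g *m p).
- by rewrite /= mulmxA act_mx !mulmxA gpk.
- rewrite /= genmxE mulmxA submxMr // sub_capmx.
  rewrite (submx_trans (marked_mx g)) ?capmxSl //.
  by rewrite -gpk !mulmxA submxMl.
exists h; split=> [|h' hE'].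
  by apply: mx_inj; rewrite mx_comp k'E hE.
by apply: mx_inj; rewrite hE -hE' mx_comp k'E -mulmxA kp mulmx1.
Qed.

Lemma mcat_cokernel A B (f : hom A B) :
  exists (Q : mcat) (q : hom B Q), cokernel_of f q /\
    forall m (g : 'M_(_, m)), mx f *m g = 0 -> exists h, g = mx q *m h.
Proof.
have [r [q [p [fq pq qp]]]] := cokermx_section (mx f).
(* The choice of [marked B] over [mark B] matters: a morphism out of [B] controls only the part of
   the mark inside the image of [act B]. *)
pose Q := MMod (p *m act B *m q) <<marked B *m q>>%MS.
have [||q' q'E] := @mhomP B Q q.
- by rewrite /= -mulmxA qp // mulmxA -act_mx -mulmxA fq mulmx0.
- by rewrite /= genmxE.
exists Q, q'; rewrite q'E; split=> [|m g /qp <-]; last by eexists.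
split=> [|X g gf]; first by apply: mx_inj; rewrite mx_comp q'E.
have qg : q *m (p *m mx g) = mx g by rewrite qp // -mx_comp gf.
have [||h hE] := @mhomP Q X (p *m mx g).
- by rewrite /= -mulmxA qg -!mulmxA act_mx.
- rewrite (submx_trans (submxMr _ (capmxSl _ _))) //= (eqmxMr _ (genmxE _)).
  by rewrite -mulmxA qg (submx_trans (marked_mx g)) ?capmxSl.
exists h; split=> [|h' hE']; first by apply: mx_inj; rewrite mx_comp q'E hE.
by apply: mx_inj; rewrite hE -hE' mx_comp q'E mulmxA pq mul1mx.
Qed.

Lemma mcat_biproduct A B :
  exists (P : mcat) (i1 : hom A P) (i2 : hom B P) (p1 : hom P A) (p2 : hom P B),
    is_biproduct i1 i2 p1 p2.
Proof.
pose P := MMod (block_mx (act A) 0 0 (act B))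
               (block_mx (marked A) 0 0 (marked B)).
have [||i1 i1E] := @mhomP A P (row_mx 1%:M 0).
- by rewrite /= mul_row_block mul_mx_row !mulmx0 !mul0mx mulmx1 mul1mx !addr0.
- rewrite mul_mx_row mulmx0 mulmx1 /=.
  by apply/submxP; exists (row_mx 1%:M 0);
     rewrite mul_row_block !mulmx0 !mul0mx mul1mx !addr0.
have [||i2 i2E] := @mhomP B P (row_mx 0 1%:M).
- by rewrite /= mul_row_block mul_mx_row !mulmx0 !mul0mx mulmx1 mul1mx !add0r.
- rewrite mul_mx_row mulmx0 mulmx1 /=.
  by apply/submxP; exists (row_mx 0 1%:M);
     rewrite mul_row_block !mulmx0 !mul0mx mul1mx !add0r.
have [||p1 p1E] := @mhomP P A (col_mx 1%:M 0).
- by rewrite /= mul_block_col mul_col_mx !mulmx0 !mul0mx mulmx1 mul1mx !addr0.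
- rewrite (submx_trans (submxMr _ (capmxSl _ _))) //= mul_block_col mul0mx.
  by rewrite mulmx1 mulmx0 mul0mx !addr0 col_mx_sub capmxSl sub0mx.
have [||p2 p2E] := @mhomP P B (col_mx 0 1%:M).
- by rewrite /= mul_block_col mul_col_mx !mulmx0 !mul0mx mulmx1 mul1mx !add0r.
- rewrite (submx_trans (submxMr _ (capmxSl _ _))) //= mul_block_col mul0mx.
  by rewrite mulmx1 mulmx0 mul0mx !add0r col_mx_sub capmxSl sub0mx.
exists P, i1, i2, p1, p2; split; apply: mx_inj;
  rewrite ?mxD !mx_comp ?mx_idm ?i1E ?i2E ?p1E ?p2E ?mul_row_col ?mul_col_row
    ?mulmx0 ?mul0mx ?mulmx1 ?addr0 ?add0r //.
by rewrite add_block_mx !addr0 !add0r -scalar_mx_block.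
Qed.

Lemma mcat_preabelian : preabelian mcat.
Proof.
split=> [|A B f]; last first.
  split.
    by have [K [k [kP _]]] := mcat_kernel f; exists K, k.
  by have [Q [q [qP _]]] := mcat_cokernel f; exists Q, q.
split; last exact: mcat_biproduct.
exists (MMod (0 : 'M_0) 0); split=> X; exists 0; split=> // f _; apply: mx_inj.
  by rewrite [mx f]thinmx0 [mx 0]thinmx0.
by rewrite [mx f]flatmx0 [mx 0]flatmx0.
Qed.

(** * Monomorphisms, epimorphisms and integrality *)

Lemma monoP A B (f : hom A B) : monomorphism f <-> row_free (mx f).
Proof.
split=> [fmono|ffree X g h /(congr1 (@mx _ _))]; last first.
  by rewrite !mx_comp => /(row_free_inj ffree)/mx_inj.
have [K [k [[fk _] kerk]]] := mcat_kernel f.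
have k0 : k = 0.
  by apply: fmono; rewrite fk; apply: mx_inj; rewrite mx_comp mx0 mul0mx.
have [h] := kerk _ _ (mulmx_ker (mx f)).
by rewrite k0 mx0 mulmx0 -kermx_eq0 => ->.
Qed.

Lemma epiP A B (f : hom A B) : epimorphism f <-> row_full (mx f).
Proof.
split=> [fepi|ffull X g h /(congr1 (@mx _ _))]; last first.
  by rewrite !mx_comp => /(row_full_inj ffull)/mx_inj.
have [Q [q [[qf _] factq]]] := mcat_cokernel f.
have q0 : q = 0.
  by apply: fepi; rewrite qf; apply: mx_inj; rewrite mx_comp mx0 mulmx0.
have [h] := factq _ _ (mulmx_coker (mx f)).
by rewrite q0 mx0 mul0mx -cokermx_eq0 => ->.
Qed.

Lemma mcat_integral : integral mcat.
Proof.
split; first exact: mcat_preabelian.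
- move=> A B Y D a b c d [_ sqU] /epiP dfull.
  apply/epiP/row_fullP.
  (* A linear lift [y] of [c] along [d] gives a linear map [w] from [B] to the fibre product [K].
     Following it by the comparison map [h] yields a linear section of [a], so [a] is surjective. *)
  have [P [i1 [i2 [p1 [p2 [p1i1 p2i2 p1i2 p2i1 _]]]]]] := mcat_biproduct B Y.
  have [K [k [[fk _] kerk]]] := mcat_kernel (c \oc p1 - d \oc p2).
  have [|h [[ah _] _]] := sqU _ (p1 \oc k) (p2 \oc k).
    apply/mx_inj/eqP; rewrite -subr_eq0 !mx_comp -!mulmxA -mulmxBr.
    by move/(congr1 (@mx _ _)): fk; rewrite mx_comp mxB !mx_comp => ->.
  have [y yd] : exists y, y *m mx d = mx c.
    by have /row_fullP[s sd] := dfull; exists (mx c *m s); rewrite -mulmxA sd mulmx1.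
  have [|w wE] := kerk _ (mx i1 + y *m mx i2).
    rewrite mxB !mx_comp mulmxDl !mulmxBr -!mulmxA.
    rewrite ![mx _ *m (mx _ *m mx _)]mulmxA -!mx_comp p1i1 p2i1 p1i2 p2i2.
    rewrite !compm1 !compm0 !mx0 mulmx0 yd.
    by rewrite subr0 sub0r subrr.
  exists (w *m mx h); rewrite -mulmxA -mx_comp ah mx_comp mulmxA -wE mulmxDl.
  by rewrite -mulmxA -!mx_comp p1i1 p1i2 mx0 mulmx0 addr0.
- move=> A B Y D a b c d [_ sqU] /monoP afree.
  apply/monoP/row_freeP.
  (* Dually, a linear extension [y] of [b] along [a] gives a linear map [w] from the amalgamated sum
     [Q] to [Y], whence a linear retraction of [d]. *)
  have [P [i1 [i2 [p1 [p2 [p1i1 p2i2 p1i2 p2i1 _]]]]]] := mcat_biproduct B Y.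
  have [Q [q [[qf _] factq]]] := mcat_cokernel (i1 \oc a - i2 \oc b).
  have [|h [[_ hd] _]] := sqU _ (q \oc i1) (q \oc i2).
    apply/mx_inj/eqP; rewrite -subr_eq0 !mx_comp !mulmxA -mulmxBl.
    by move/(congr1 (@mx _ _)): qf; rewrite mx_comp mxB !mx_comp => ->.
  have [y ay] : exists y, mx a *m y = mx b.
    by have /row_freeP[s sa] := afree; exists (s *m mx b); rewrite mulmxA sa mul1mx.
  have [|w wE] := factq _ (mx p1 *m y + mx p2).
    rewrite mxB !mx_comp mulmxDr !mulmxBl !mulmxA.
    rewrite -!mx_comp !compA p1i1 p2i1 p1i2 p2i2.
    rewrite !comp1m !comp0m !mx0 mul0mx ay.
    by rewrite subr0 sub0r subrr.
  exists (mx h *m w); rewrite mulmxA -mx_comp hd mx_comp -mulmxA -wE mulmxDr.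
  by rewrite mulmxA -!mx_comp p1i2 p2i2 mx0 mul0mx add0r.
Qed.

(** * A pullback of a cokernel that is not a cokernel *)

Lemma mcat_not_quasi_abelian : ~ quasi_abelian mcat.
Proof.
case=> preab cokerpb _.
(* The rows [e] and [r] are the basis vectors e and xe, the columns [c] and [s] their coordinate
   functions; [N] below is the action of x. *)
pose c : 'M[F]_(2, 1) := delta_mx 0 0; pose s : 'M[F]_(2, 1) := delta_mx 1 0.
pose e : 'M[F]_(1, 2) := delta_mx 0 0; pose r : 'M[F]_(1, 2) := delta_mx 0 1.
have ec : e *m c = 1%:M.
  by rewrite mul_delta_mx; apply/matrixP=> i j; rewrite !ord1 !mxE.
have rc : r *m c = 0 by rewrite mul_delta_mx_cond.
have ce_sr : c *m e + s *m r = 1%:M.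
  rewrite !mul_delta_mx mx1_sum_delta big_ord_recl big_ord1.
  by rewrite (_ : lift _ _ = 1) //; apply: val_inj.
pose N := c *m r.
have eN : e *m N = r by rewrite mulmxA ec mul1mx.
have rN : r *m N = 0 by rewrite mulmxA rc mul0mx.
have Nc : N *m c = 0 by rewrite -mulmxA rc mulmx0.
have N0 : N <> 0.
  move=> N0; move: eN; rewrite N0 mulmx0 => /esym/matrixP/(_ 0 1)/eqP.
  by rewrite !mxE /= oner_eq0.
pose Y : mcat := MMod N 0; pose B : mcat := MMod N N.
pose D : mcat := MMod (0 : 'M_1) 0.
have [||c' c'E] := @mhomP B D c.
- by rewrite /= Nc mulmx0.
- by rewrite (submx_trans (submxMr _ (capmxSl _ _))) //= Nc sub0mx.
have [||d' d'E] := @mhomP Y D c.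
- by rewrite /= Nc mulmx0.
- by rewrite (submx_trans (submxMr _ (capmxSl _ _))) //= mul0mx sub0mx.
have d'coker : is_cokernel d'.
  have [||f fE] := @mhomP D Y r.
  - by rewrite /= mul0mx rN.
  - by rewrite (submx_trans (submxMr _ (capmxSl _ _))) //= mul0mx sub0mx.
  exists D, f; split; first by apply: mx_inj; rewrite mx_comp fE d'E rc.
  move=> X g /(congr1 (@mx _ _)); rewrite mx_comp fE mx0 => rg.
  have gE : c *m (e *m mx g) = mx g.
    by rewrite -[RHS]mul1mx -ce_sr mulmxDl -!mulmxA rg mulmx0 addr0.
  have [||h hE] := @mhomP D X (e *m mx g).
  - by rewrite /= mul0mx -mulmxA -(act_mx g) mulmxA eN rg.
  - by rewrite (submx_trans (submxMr _ (capmxSl _ _))) //= mul0mx sub0mx.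
  exists h; split=> [|h' hE']; apply: mx_inj.
    by rewrite mx_comp d'E hE gE.
  by rewrite hE -hE' mx_comp d'E mulmxA ec mul1mx.
have [A [a [b sq]]] := pullback_exists c' d' preab.
have [E [g [ag aU]]] := cokerpb _ _ _ _ _ _ _ _ sq d'coker.
have aN : mx a *m N = mx b *m N.
  by case: sq => /(congr1 (@mx _ _)) + _; rewrite !mx_comp c'E d'E !mulmxA => ->.
(* A marked element of [A] is a multiple of x, and [a] and [b] agree on such elements by [aN]; its
   image under [b] is marked in [Y], hence zero. *)
have a0 : marked A *m mx a = 0.
  have /submxP[w wE] : (marked A <= act A)%MS := capmxSr _ _.
  rewrite wE -mulmxA act_mx /= aN -[N]/(act Y) -act_mx mulmxA -wE.
  by apply/eqP; rewrite -submx0 (submx_trans (marked_mx b)) ?capmxSl.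
(* The matrix of [a] is thus also a morphism to [Y], and factors through the cokernel [a] by some
   [h]. *)
have [||a' a'E] := @mhomP A Y (mx a); [exact: (act_mx a) | by rewrite a0 sub0mx |].
have [|h [ha _]] := aU _ a'.
  by apply: mx_inj; move/(congr1 (@mx _ _)): ag; rewrite !mx_comp a'E.
have [||i iE] := @mhomP Y B 1%:M.
- by rewrite mul1mx mulmx1.
- by rewrite (submx_trans (submxMr _ (capmxSl _ _))) //= mul0mx sub0mx.
have [j [_ idU]] := aU _ a ag.
(* Uniqueness of factorizations through [a] forces [h] to be the identity matrix, which would send
   the nonzero mark of [B] into the zero mark of [Y]. *)
have h1 : mx h = 1%:M.
  have ih1 : i \oc h = idm B.
    rewrite -(idU (idm B)) ?comp1m //; apply/esym/idU.
    by rewrite -compA ha; apply: mx_inj; rewrite mx_comp iE a'E mulmx1.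
  by rewrite -(mx_idm B) -ih1 mx_comp iE mulmx1.
have := submx_trans (marked_mx h) (capmxSl _ _).
rewrite h1 mulmx1 => markedB; apply/N0/eqP.
by rewrite -submx0 (submx_trans _ markedB) // sub_capmx submx_refl.
Qed.

End MarkedModules.

Theorem corollary3p6 :
  exists C : preadditive, integral C /\ ~ quasi_abelian C.
Proof.
exists (mcat rat); split.
  exact: mcat_integral.
exact: mcat_not_quasi_abelian.
Qed.
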